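(* Let $n \ge 2$ be an integer and let $G = L(S(S_n))$ be the line graph of the subdivision graph of the star $S_n$ with $n$ vertices. Then the F-index of $G$ is $F(G) = n(n-1)(n^2-3n+3)$.
   Context: For a simple graph $H$, $d(u)$ denotes the degree of a vertex $u$ in $H$. The F-index of $H$ is $F(H) = \sum_{u \in V(H)} d^3(u) = \sum_{uv \in E(H)} [d^2(u)+d^2(v)]$. The subdivision graph $S(H)$ is the graph obtained from $H$ by inserting one additional vertex into each edge of $H$ (each edge is replaced by a path of length 2). The line graph $L(H)$ is the simple graph whose vertices are the edges of $H$, two distinct ones being adjacent when they share a common endpoint in $H$. $S_n$ is the star on $n$ vertices: one central vertex joined to $n-1$ leaves. *)

(* Defs.v *)
From mathcomp Require Import all_boot all_order all_algebra.

Set Implicit Arguments.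
Unset Strict Implicit.
Unset Printing Implicit Defensive.

Record sgraph := SGraph {
  vert :> finType;
  adj : rel vert;
  adj_sym : symmetric adj;
  adj_irr : irreflexive adj
}.

Definition degree (H : sgraph) (u : H) : nat := #|[set v : H | adj u v]|.

Definition edges (H : sgraph) : {set {set H}} :=
  [set [set p.1; p.2] | p : H * H & adj p.1 p.2].

Definition edge (H : sgraph) : finType := {e : {set H} | e \in edges H}.

Definition F_index (H : sgraph) : nat := \sum_(u : H) degree u ^ 3.

Section Subdivision.
Variable H : sgraph.

(* [inr e] is the vertex inserted into the edge [e]. *)
Definition subdivision_rel (x y : (H + edge H)%type) : bool :=
  match x, y with
  | inl v, inr e | inr e, inl v => v \in val e
  | _, _ => false
  end.

Lemma subdivision_sym : symmetric subdivision_rel.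
Proof. by case=> [u|e] [v|f]. Qed.

Lemma subdivision_irr : irreflexive subdivision_rel.
Proof. by case. Qed.

Definition subdivision : sgraph := SGraph subdivision_sym subdivision_irr.

End Subdivision.

Section LineGraph.
Variable H : sgraph.

Definition line_rel (e f : edge H) : bool :=
  (e != f) && [exists v : H, (v \in val e) && (v \in val f)].

Lemma line_sym : symmetric line_rel.
Proof.
move=> e f; rewrite /line_rel eq_sym; congr andb.
by apply: eq_existsb => v; rewrite andbC.
Qed.

Lemma line_irr : irreflexive line_rel.
Proof. by move=> e; rewrite /line_rel eqxx. Qed.

Definition line_graph : sgraph := SGraph line_sym line_irr.

End LineGraph.

Section Star.
Variable n : nat.

(* The centre is the vertex of value 0; the condition is put on values so that
   the graph is defined for every [n]. *)
Definition star_rel (i j : 'I_n) : bool :=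
  (i != j) && ((val i == 0) || (val j == 0)).

Lemma star_sym : symmetric star_rel.
Proof. by move=> i j; rewrite /star_rel eq_sym orbC. Qed.

Lemma star_irr : irreflexive star_rel.
Proof. by move=> i; rewrite /star_rel eqxx. Qed.

Definition star : sgraph := SGraph star_sym star_irr.

End Star.

(* Main.v *)
Require Import Defs.
From mathcomp Require Import all_boot all_order all_algebra.
From mathcomp Require Import ring.

Set Implicit Arguments.
Unset Strict Implicit.
Unset Printing Implicit Defensive.

(** For every graph [H], the F-index of [L(S(H))] is the sum of the fourth
    powers of the degrees of [H] ([F_index_line_subdivision]).  The vertices of
    [L(S(H))] are the incident pairs (v, e) of [H].  An edge xy of any graph
    meets d(x) + d(y) - 2 other edges ([degree_line]); in [S(H)] the vertex v
    keeps its degree d(v) and the vertex inserted into e has degree 2, so the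
    pair (v, e) has degree d(v) in [L(S(H))].  Since v lies in d(v) such pairs,
    it contributes d(v) * d(v)^3.

    The star has a centre of degree n - 1 and n - 1 leaves of degree 1, so the
    index is (n - 1)^4 + (n - 1), which factors as n (n - 1) (n^2 - 3n + 3). *)

Section Incidence.
Variable H : sgraph.
Implicit Types u v : H.

Lemma edgesP (e : {set H}) :
  reflect (exists u v, adj u v /\ e = [set u; v]) (e \in edges H).
Proof.
apply: (iffP imsetP) => [[[u v] + ->] | [u [v [uv ->]]]].
  by rewrite inE => uv; exists u, v.
by exists (u, v); rewrite ?inE.
Qed.

Definition incident v : {set edge H} := [set e : edge H | v \in val e].

Lemma mem_edge_set2 u v : adj u v -> [set u; v] \in edges H.
Proof. by move=> uv; apply/edgesP; exists u, v; split. Qed.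

Lemma adj_neq u v : adj u v -> u != v.
Proof. by apply: contraTneq => ->; rewrite adj_irr. Qed.

Lemma edge_through u (e : edge H) : u \in val e ->
  exists2 v, adj u v & val e = [set u; v].
Proof.
have /edgesP [x [y [xy ->]]] := valP e.
rewrite !inE => /orP [] /eqP ->; first by exists y.
by exists x; [rewrite adj_sym | rewrite setUC].
Qed.

Lemma set2_inj u v w : u != v -> [set u; v] = [set u; w] -> v = w.
Proof.
move=> uv E; have : v \in [set u; w] by rewrite -E !inE eqxx orbT.
by rewrite !inE eq_sym (negbTE uv) => /eqP.
Qed.

(** An edge through [v] is determined by its other endpoint. *)
Lemma card_incident v : #|incident v| = degree v.
Proof.
rewrite -(card_imset _ val_inj) /degree.
rewrite -(card_in_imset (f := fun w => [set v; w])); last first.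
  by move=> w w'; rewrite !inE => vw _; apply: set2_inj; apply: adj_neq.
apply: eq_card => e; apply/imsetP/imsetP => [[f] | [w]].
  rewrite inE => /edge_through [w vw E] ->.
  by exists w; rewrite ?inE.
rewrite inE => vw ->; exists (Sub [set v; w] (mem_edge_set2 vw)) => //.
by rewrite inE /= !inE eqxx.
Qed.

Lemma card_edge (e : edge H) : #|val e| = 2.
Proof.
by have /edgesP [u [v [uv ->]]] := valP e; rewrite cards2 (adj_neq uv).
Qed.

(** The edges meeting [uv] are those through [u] and those through [v]; only
    [uv] itself is counted twice, and it is not its own neighbour.  Stated
    additively because subtraction on [nat] truncates. *)
Lemma degree_line (e : edge H) u v : u != v -> val e = [set u; v] ->
  @degree (line_graph H) e + 2 = degree u + degree v.
Proof.
move=> uv E; rewrite -!card_incident -cardsUI.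
have -> : incident u :&: incident v = [set e].
  apply/setP=> f; rewrite !inE; apply/andP/eqP => [[uf vf] | ->].
    apply/eqP; rewrite eq_sym -val_eqE eqEcard !card_edge leqnn andbT E.
    by apply/subsetP=> x; rewrite !inE => /orP [] /eqP ->.
  by rewrite E !inE !eqxx orbT.
have eU : e \in incident u :|: incident v by rewrite !inE E !inE eqxx.
rewrite cards1 (cardsD1 e) eU /degree addnAC addnC; congr (_ + _).
apply: eq_card => f; rewrite !inE /= /line_rel.
rewrite eq_sym; congr (_ && _); apply/existsP/orP.
  case=> x; rewrite E !inE => /andP [] /orP [] /eqP ->; by [left | right].
by case=> xf; [exists u | exists v]; rewrite E !inE eqxx ?orbT.
Qed.

End Incidence.

Section SubdivisionLine.
Variable H : sgraph.
Local Notation S := (subdivision H).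

Lemma degree_subdivision_old (v : H) : @degree S (inl v) = degree v.
Proof.
rewrite -(card_incident v) -(card_imset (incident v) (@inr_inj H (edge H))).
apply: eq_card => -[w | e]; rewrite inE /=.
  by apply/esym/negbTE/imsetP => -[].
by rewrite mem_imset ?inE //; apply: inr_inj.
Qed.

Lemma degree_subdivision_new (e : edge H) : @degree S (inr e) = 2.
Proof.
rewrite -(card_edge e) -(card_imset (val e) (@inl_inj H (edge H))).
apply: eq_card => -[v | f]; rewrite inE /=.
  by rewrite mem_imset //; apply: inl_inj.
by apply/esym/negbTE/imsetP => -[].
Qed.

Lemma edge_subdivision (x : edge S) :
  exists (v : H) (e : edge H), val x = [set inl v; inr e].
Proof.
have /edgesP [[v | e] [[w | f] [// _ ->]]] := valP x; first by exists v, f.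
by exists w, e; rewrite setUC.
Qed.

Lemma degree_line_subdivision (x : edge S) (v : H) : inl v \in val x ->
  @degree (line_graph S) x = degree v.
Proof.
have [w [e E]] := edge_subdivision x.
rewrite E !inE orbF => /eqP [->]; apply: (@addIn 2).
by rewrite (degree_line _ E) // degree_subdivision_old degree_subdivision_new.
Qed.

(** Sort the edges of [S(H)] by their unique endpoint among the original
    vertices: [v] is the endpoint of d(v) of them, each of degree d(v). *)
Lemma F_index_line_subdivision :
  F_index (line_graph S) = \sum_(v : H) degree v ^ 4.
Proof.
transitivity (\sum_(x : edge S) \sum_(v : H | inl v \in val x) degree v ^ 3).
  apply: eq_bigr => x _; have [v [e E]] := edge_subdivision x.
  rewrite (big_pred1 v) => [|w]; last by rewrite E !inE orbF.
  by rewrite (@degree_line_subdivision x v) // E !inE eqxx.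
rewrite (exchange_big_dep xpredT) //=; apply: eq_bigr => v _.
rewrite sum_nat_const [RHS]expnS -[X in _ = X * _]degree_subdivision_old.
rewrite -(card_incident (inl v : S)); congr (_ * _).
by apply: eq_card => x; rewrite inE.
Qed.

End SubdivisionLine.

Lemma degree_star_center m : @degree (star m.+1) ord0 = m.
Proof.
rewrite /degree -[RHS]/(m.+1.-1) -[X in X.-1]card_ord -(cardsC1 ord0).
by apply: eq_card => i; rewrite !inE /= /star_rel /= andbT eq_sym.
Qed.

Lemma degree_star_leaf m (i : 'I_m.+1) : i != ord0 -> @degree (star m.+1) i = 1.
Proof.
move=> i0; rewrite /degree -(cards1 (ord0 : 'I_m.+1)).
apply: eq_card => j; rewrite !inE /= /star_rel.
rewrite -[val i == 0]/(i == ord0) -[val j == 0]/(j == ord0) (negbTE i0) /=.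
by case: (j =P ord0) => [-> | _]; rewrite ?i0 ?andbF.
Qed.

Theorem theorem3 (n : nat) (hn : 2 <= n) :
  ((F_index (line_graph (subdivision (star n))))%:Z =
   n%:Z * (n%:Z - 1) * (n%:Z ^+ 2 - 3 * n%:Z + 3))%R.
Proof.
case: n hn => // m _; rewrite F_index_line_subdivision.
rewrite (bigD1 (ord0 : star m.+1)) //= degree_star_center.
have -> : \sum_(i : star m.+1 | i != ord0) degree i ^ 4 = m.
  rewrite (eq_bigr (fun=> 1)) => [|i i0]; last by rewrite degree_star_leaf.
  by rewrite sum1_card (cardC1 (ord0 : 'I_m.+1)) card_ord.
ring.
Qed.
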